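(* For every $\epsilon > 0$ and all sufficiently large $n$, every randomized algorithm in the LOCAL model which, on the $n$-node path $P_n$ with a uniformly random labelling, outputs an independent set with expected approximation factor at most $1+\epsilon$ for Maximum Independent Set requires $\Omega(\frac{1}{\epsilon})$ rounds.
   Context: $P_n$ is the path with vertices $v_1,\dots,v_n$ and edges $v_iv_{i+1}$. Each node $v_i$ receives a unique label $\ell(v_i)$, where $\ell$ is chosen uniformly at random among all bijections $V \to \{1,\dots,n\}$. In the LOCAL model, each node initially knows its label and its neighbors; computation proceeds in synchronous rounds in which every node performs unlimited local computation (possibly using private random bits) and sends messages of unbounded size to its neighbors; at termination each node knows whether it is in the output independent set $I$. Having expected approximation factor at most $1+\epsilon$ means $(1+\epsilon)\,\mathbb{E}|I| \ge \alpha(P_n) = \lceil n/2 \rceil$, where the expectation is over the random bits of the algorithm and the random labelling. *)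

(* Defs.v *)
From HB Require Import structures.
From mathcomp Require Import all_boot all_order all_algebra all_fingroup.
From mathcomp Require Import all_classical all_reals all_analysis.

Set Implicit Arguments.
Unset Strict Implicit.
Unset Printing Implicit Defensive.

Import Order.TTheory GRing.Theory Num.Theory.

Local Open Scope classical_set_scope.
Local Open Scope ring_scope.

Section Graphs.
Variables (V : finType) (e : rel V).

Definition independent (I : {set V}) : bool :=
  [forall u in I, forall v in I, ~~ e u v].

Definition alpha : nat := (\max_(I : {set V} | independent I) #|I|)%N.

End Graphs.

Definition path_edge (n : nat) : rel 'I_n :=
  fun u v => (u.+1 == v :> nat) || (v.+1 == u :> nat).

(* A node is given its own label, the set of labels of its neighbors (as a
   predicate) and its private infinite stream of random bits; nodes have no
   other identity. Neighbors are addressed through their labels: [send st x] is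
   the message sent to the neighbor labelled x, and the inbox passed to
   [receive] maps x to [Some m] when a neighbor labelled x sent m, and to
   [None] when no neighbor has label x. *)
Record local_algorithm := LocalAlgorithm {
  state : Type;
  message : Type;
  init : nat -> pred nat -> (nat -> bool) -> state;
  send : state -> nat -> message;
  receive : state -> (nat -> option message) -> state;
  output : state -> bool
}.

Section Execution.
Variables (V : finType) (e : rel V) (A : local_algorithm).
Variables (lab : V -> nat) (bits : V -> nat -> bool).

Definition neighbor_labels (v : V) : pred nat :=
  fun x => [exists u, e v u && (lab u == x)].

(* With injective labels at most one neighbor u of v has label x. *)
Definition inbox (st : V -> state A) (v : V) (x : nat) : option (message A) :=
  omap (fun u => send (st u) (lab v)) [pick u | e v u && (lab u == x)].

Fixpoint run (t : nat) : V -> state A :=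
  if t is t'.+1 then fun v => receive (run t' v) (inbox (run t') v)
  else fun v => init A (lab v) (neighbor_labels v) (bits v).

Definition output_set (T : nat) : {set V} := [set v | output (run T v)]%SET.

End Execution.

(* A permutation s of 'I_n stands for the bijection v |-> (s v).+1 onto
   {1, ..., n}. *)
Definition label_of (n : nat) (s : {perm 'I_n}) (v : 'I_n) : nat := (s v).+1.

Definition path_output (n : nat) (A : local_algorithm) (T : nat)
    (s : {perm 'I_n}) (bits : 'I_n -> nat -> bool) : {set 'I_n} :=
  output_set (@path_edge n) A (label_of s) bits T.

(* Product sigma-algebra on the bit assignments of the n nodes. *)
Definition measurable_bits (n : nat) : set_system ('I_n -> nat -> bool) :=
  <<s [set C | exists v k, C = [set bits : 'I_n -> nat -> bool | bits v k]] >>.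

(* Each node's decision is a measurable function of the random bits, so that
   its probability is determined by the law of the bits. *)
Definition measurable_output (n : nat) (A : local_algorithm) (T : nat) : Prop :=
  forall (s : {perm 'I_n}) (v : 'I_n),
    @measurable_bits n [set bits | v \in path_output A T s bits].

(* The labelling L is uniform, the bits (b v k) are fair, and L and all the
   bits are mutually independent: on every cylinder event the joint law is the
   product law. *)
Definition uniform_labelling_and_bits (R : realType) (d : measure_display)
    (W : measurableType d) (P : probability W R) (n : nat)
    (L : W -> {perm 'I_n}) (b : W -> 'I_n -> nat -> bool) : Prop :=
  [/\ forall s, measurable [set w | L w = s],
      forall v k, measurable [set w | b w v k] &
      forall (s : {perm 'I_n}) (K : nat) (a : 'I_n -> nat -> bool),
        P [set w | L w = s /\ forall v k, (k < K)%N -> b w v k = a v k] =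
        ((n`!)%:R^-1 * 2^-1 ^+ (n * K))%:E].

Definition expected_size (R : realType) (d : measure_display)
    (W : measurableType d) (P : probability W R) (n : nat)
    (I : W -> {set 'I_n}) : \bar R :=
  'E_P[fun w => (#|I w|)%:R].

Definition expected_approx_factor_le (R : realType) (d : measure_display)
    (W : measurableType d) (P : probability W R) (n : nat)
    (I : W -> {set 'I_n}) (r : R) : Prop :=
  (((alpha (@path_edge n))%:R)%:E <= r%:E * expected_size P I)%E.

(* Main.v *)
(** In an independent set of the path at most one end of each edge is
    chosen, so 2|I| falls short of n by the number of edges with no end chosen;
    without such an edge between two nodes, the chosen nodes alternate. Let u, w
    be nodes at even distance 2T+4 and w+1 the successor of w. The views after T
    rounds of u and w, and of u and w+1, consist of disjoint segments of the path,
    and since the labels are exchangeable and the bits independent, "u and w agree"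
    has the same probability as "u and w+1 agree". Alternation throughout [u, w+1]
    would make the first happen and the second fail, so in expectation every block
    of 2T+5 consecutive edges contains at least 1/2 edge with no end chosen, a loss
    of order n/T. *)

Require Import Defs.
From HB Require Import structures.
From mathcomp Require Import all_boot all_order all_algebra all_fingroup.
From mathcomp Require Import all_classical all_reals all_analysis.
From mathcomp Require Import measurable_realfun zify lra.

Set Implicit Arguments.
Unset Strict Implicit.
Unset Printing Implicit Defensive.

Import Order.TTheory GRing.Theory Num.Theory.

Local Open Scope classical_set_scope.
Local Open Scope ring_scope.

(** * Locality: a run seen through a local isomorphism *)

(** As [y] ranges over all nodes, [f] carries the neighbors of each node within [t] steps of [v]
    exactly onto the neighbors of its image, so no foreign neighbor can appear. *)
Fixpoint ball_iso (V : finType) (e : rel V) (f : {perm V}) (t : nat) (v : V) : Prop :=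
  (forall y, e (f v) (f y) = e v y) /\
  (if t is t'.+1 then forall y, e v y -> ball_iso e f t' y else True).

Lemma ball_isoS (V : finType) (e : rel V) (f : {perm V}) (t : nat) (v : V) :
  ball_iso e f t.+1 v -> ball_iso e f t v.
Proof.
elim: t v => [v []//|t IH v [ev nv]].
by split => // y vy; apply: IH; exact: nv.
Qed.

(** A round reads only the neighbors' states. [f] matches the neighbors of [v] with those of [f v],
    and distinct labels force the sender picked for a label at [f v] to be the image of the one
    picked at [v]. *)
Lemma run_perm (V : finType) (e : rel V) (A : local_algorithm) (f : {perm V})
    (lab lab' : V -> nat) (bits bits' : V -> nat -> bool) (t : nat) (v : V) :
  injective lab -> (forall x, lab' (f x) = lab x) ->
  (forall x, bits' (f x) = bits x) -> ball_iso e f t v ->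
  run e A lab' bits' t (f v) = run e A lab bits t v.
Proof.
move=> lab_inj labE bitsE; elim: t v => [|t IH] v.
  move=> [ev _] /=; rewrite labE bitsE; congr init.
  apply: funext => x; apply/existsP/existsP => -[u /andP[vu /eqP ux]].
    exists (f^-1 u)%g; rewrite -ev permKV vu -labE permKV; exact/eqP.
  by exists (f u); rewrite ev vu labE; apply/eqP.
move=> iso; have [ev nv] := iso; rewrite /= IH; last exact: ball_isoS.
congr receive; apply: funext => x; rewrite /inbox labE.
case: pickP => [u /andP[vu /eqP ux]|no]; case: pickP => [y /andP[vy /eqP yx]|no'] //=.
- have uE : u = f y.
    by rewrite -[u](permKV f); congr (f _); apply: lab_inj; rewrite yx -ux -labE permKV.
  by rewrite uE IH//; exact: nv.
- by have := no' (f^-1 u)%g; rewrite -ev permKV vu -labE permKV ux eqxx.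
- by have := no (f y); rewrite ev vy labE yx eqxx.
Qed.

(** * Rotation of a tail of the path *)

Definition rotate_tail_fun (n c : nat) (x : 'I_n.+1) : 'I_n.+1 :=
  inord (if (x < c)%N then x : nat else if (x < n)%N then x.+1 else c).

Lemma rotate_tail_funE (n c : nat) (x : 'I_n.+1) : (c <= n)%N ->
  rotate_tail_fun c x = (if (x < c)%N then x : nat else if (x < n)%N then x.+1 else c) :> nat.
Proof.
by move=> cn; rewrite inordK//; have := ltn_ord x; case: ifP; [|case: ifP]; lia.
Qed.

Lemma rotate_tail_inj (n c : nat) : (c <= n)%N -> injective (@rotate_tail_fun n c).
Proof.
move=> cn x y /(congr1 (@nat_of_ord _)); rewrite !rotate_tail_funE//.
have := ltn_ord x; have := ltn_ord y.
by move=> xn yn; do ![case: ifP]; move=> *; apply: val_inj => /=; lia.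
Qed.

(** The rotation disturbs adjacency only at [c - 1], [c], [n - 1] and [n]; the hypothesis keeps the
    ball of radius [t] away from these positions. *)
Lemma ball_iso_path (n c : nat) (cn : (c <= n)%N) (t : nat) (v : 'I_n.+1) :
  (v + t + 2 <= c)%N || (c + t < v)%N && (v + t + 2 <= n)%N ->
  ball_iso (@path_edge n.+1) (perm (rotate_tail_inj cn)) t v.
Proof.
elim: t v => [|t IH] v vt.
  split=> // y; rewrite /path_edge !permE !rotate_tail_funE//.
  by have := ltn_ord v; have := ltn_ord y; do ![case: ifP]; lia.
split=> [y|y vy].
  rewrite /path_edge !permE !rotate_tail_funE//.
  by have := ltn_ord v; have := ltn_ord y; do ![case: ifP]; lia.
by apply: IH; move: vy; rewrite /path_edge; lia.
Qed.

(** * Counting the edges with no end chosen *)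

Definition zero_edge (n : nat) (S : {set 'I_n.+1}) (i : nat) : nat :=
  ((inord i \notin S) && (inord i.+1 \notin S)).

Lemma independent_edge (n : nat) (S : {set 'I_n.+1}) (i : nat) :
  independent (@path_edge n.+1) S -> (i < n)%N ->
  ((inord i \in S) + (inord i.+1 \in S) + zero_edge S i)%N = 1%N.
Proof.
move=> /forallP/(_ (inord i)) indS i_n; rewrite /zero_edge.
case iS : (inord i \in S) indS => /=; last by case: (_ \in S).
move=> /forallP/(_ (inord i.+1)); case: (inord i.+1 \in S) => //=.
by rewrite /path_edge !inordK ?eqxx//; lia.
Qed.

(** Summing [independent_edge] over the [n] edges counts every node twice, except the two ends of
    the path, which are counted once; they account for the [2]. *)
Lemma card_zero_edges (n : nat) (S : {set 'I_n.+1}) :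
  independent (@path_edge n.+1) S ->
  (2 * #|S| + \sum_(0 <= i < n) zero_edge S i <= n + 2)%N.
Proof.
move=> indS; pose x i : nat := inord i \in S.
have cardE : #|S| = (\sum_(0 <= i < n.+1) x i)%N.
  rewrite -sum1_card big_mkcond /= big_mkord; apply: eq_bigr => i _.
  by rewrite /x inord_val; case: (i \in S).
have: (\sum_(0 <= i < n) (x i + x i.+1 + zero_edge S i) = n)%N.
  transitivity (\sum_(0 <= i < n) 1)%N; last by rewrite sum_nat_const_nat subn0 muln1.
  by apply: eq_big_nat => i /andP[_ i_n]; exact: independent_edge.
rewrite !big_split /= => sumE.
have l1 := cardE; rewrite big_nat_recr //= in l1.
have l2 := cardE; rewrite big_nat_recl //= in l2.
have := leq_b1 (inord 0 \in S); have := leq_b1 (inord n \in S).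
rewrite /x in sumE l1 l2; lia.
Qed.

(** Membership flips across every edge that has a chosen end, so a wrong parity after [m] edges
    betrays an edge without one. *)
Lemma zero_edges_parity (n : nat) (S : {set 'I_n.+1}) (u m : nat) :
  independent (@path_edge n.+1) S -> (u + m <= n)%N ->
  ((((inord u \in S) (+) (inord (u + m) \in S)) != odd m) <=
    \sum_(u <= i < u + m) zero_edge S i)%N.
Proof.
move=> indS; elim: m => [|m IH] um; first by rewrite addn0 addbb.
rewrite addnS big_nat_recr ?leq_addr//=.
have := IH ltac:(lia); have := @independent_edge n S (u + m) indS ltac:(lia).
rewrite /= /zero_edge.
by do 3![case: (_ \in S)]; case: (odd m); rewrite //=; lia.
Qed.

(** Each of the two events on the left contradicts alternation, after [m] and after [m + 1] steps.
    The factor 2 is there because one edge may be responsible for both. *)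
Lemma block_zero_edges (n : nat) (S : {set 'I_n.+1}) (u m : nat) :
  independent (@path_edge n.+1) S -> ~~ odd m -> (u + m < n)%N ->
  (((inord u \in S) != (inord (u + m) \in S)) +
   ((inord u \in S) == (inord (u + m).+1 \in S)) <=
   2 * \sum_(u <= i < u + m.+1) zero_edge S i)%N.
Proof.
move=> indS m_even um.
have := @zero_edges_parity n S u m indS ltac:(lia).
have := @zero_edges_parity n S u m.+1 indS ltac:(lia).
rewrite /= (negbTE m_even) addnS big_nat_recr ?leq_addr//=.
by do 3![case: (_ \in S)] => /=; lia.
Qed.

Lemma blocks_zero_edges (n B J : nat) (S : {set 'I_n.+1}) :
  (J * B <= n)%N ->
  (\sum_(0 <= j < J) \sum_(j * B <= i < j * B + B) zero_edge S i <=
   \sum_(0 <= i < n) zero_edge S i)%N.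
Proof.
move=> JB; rewrite [X in (_ <= X)%N](@big_cat_nat _ _ _ (J * B)) //=.
apply: leq_trans (leq_addr _ _).
elim: J {JB} => [|J IH]; first by rewrite !big_geq.
rewrite big_nat_recr//= [X in (_ <= X)%N](@big_cat_nat _ _ _ (J * B)) ?leq_mul2r//=; last by lia.
by apply: leq_add => //; rewrite mulSn addnC.
Qed.

Lemma alpha_path_ge (n : nat) : (n <= 2 * alpha (@path_edge n))%N.
Proof.
pose E := [set v : 'I_n | ~~ odd v]%SET.
have indE : independent (@path_edge n) E.
  apply/forallP => u; apply/implyP; rewrite inE => u_even.
  apply/forallP => v; apply/implyP; rewrite inE => v_even.
  rewrite /path_edge negb_or; apply/andP; split; apply/eqP => uv.
    by move: v_even; rewrite -uv /= u_even.
  by move: u_even; rewrite -uv /= v_even.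
have: (#|E| <= alpha (@path_edge n))%N by apply: leq_bigmax_cond.
suff : (n <= 2 * #|E|)%N by lia.
rewrite -sum1_card (eq_bigl (fun v : 'I_n => ~~ odd v)); last by move=> v; rewrite inE.
rewrite -(big_mkord (fun v => ~~ odd v) (fun=> 1%N)).
(* The term [odd n] records the rounding in the count of even positions and makes the induction go
   through. *)
have: (n + odd n <= 2 * \sum_(0 <= i < n | ~~ odd i) 1)%N.
  elim: n {E indE} => [|n IH]; first by rewrite big_geq.
  by rewrite big_mkcond big_nat_recr//= -big_mkcond /=; move: IH; case: (odd n) => /=; lia.
by apply: leq_trans; exact: leq_addr.
Qed.

(** * The joint law of labels and bits *)

Section RandomBits.
Context (R : realType) (d : measure_display) (W : measurableType d)
  (P : probability W R) (n : nat).
Implicit Types (L : W -> {perm 'I_n}) (b : W -> 'I_n -> nat -> bool)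
  (C : set ('I_n -> nat -> bool)).

Lemma measurable_bits_preimage L b C :
  uniform_labelling_and_bits P L b -> measurable_bits C ->
  measurable [set w | C (b w)].
Proof.
move=> [_ mb _]; apply: (@smallest_sub _ _ _ [set D | measurable [set w | D (b w)]]).
  split => /= [|D mD|D mD].
  - exact: measurable0.
  - rewrite (_ : [set w | _] = ~` [set w | D (b w)]); first exact: measurableC.
    by apply/seteqP; split => w //= [].
  - by apply: (@bigcup_measurable _ _ (fun k => [set w | D k (b w)])) => k _; exact: mD.
by move=> _ [v [k ->]]; exact: mb.
Qed.

Lemma measurable_label_bits L b s C :
  uniform_labelling_and_bits P L b -> measurable_bits C ->
  measurable [set w | L w = s /\ C (b w)].
Proof.
move=> ub mC; have [mL _ _] := ub.
exact: (measurableI _ _ (mL s) (measurable_bits_preimage ub mC)).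
Qed.

Lemma measurable_label_event L b (E : {perm 'I_n} -> set ('I_n -> nat -> bool)) :
  uniform_labelling_and_bits P L b -> (forall s, measurable_bits (E s)) ->
  measurable [set w | E (L w) (b w)].
Proof.
move=> ub mE.
rewrite (_ : [set w | _] = \bigcup_s [set w | L w = s /\ E s (b w)]); last first.
  by apply/seteqP; split => [w Ew|w [s _ [<- //]]]; exists (L w).
apply: fin_bigcup_measurable => [|s _]; first exact: finite_finset.
exact: measurable_label_bits.
Qed.

Definition bit_cylinder (K : nat) (a : 'I_n -> nat -> bool) : set ('I_n -> nat -> bool) :=
  [set bits | forall v k, (k < K)%N -> bits v k = a v k].

(** The empty set is added to obtain a pi-system: two cylinders may be disjoint. *)
Definition bit_cylinders : set (set ('I_n -> nat -> bool)) :=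
  [set C | C = set0 \/ exists K a, C = bit_cylinder K a].

Lemma setI_closed_bit_cylinders : setI_closed bit_cylinders.
Proof.
move=> _ _ [->|[K [a ->]]] [->|[K' [a' ->]]]; rewrite ?set0I ?setI0; try by left.
have [[z [za za']]|no] := pselect (bit_cylinder K a `&` bit_cylinder K' a' !=set0).
  right; exists (maxn K K'), z; apply/seteqP; split => [y [ya ya'] v k|y yz].
    by rewrite leq_max => /orP[] kK; rewrite ?(ya _ _ kK) ?(za _ _ kK) ?(ya' _ _ kK) ?(za' _ _ kK).
  by split=> v k kK; [rewrite yz ?za|rewrite yz ?za']; rewrite // leq_max kK ?orbT.
by left; apply/seteqP; split => // y yy; exfalso; apply: no; exists y.
Qed.

Lemma bit_in_cylinders (v : 'I_n) (k : nat) :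
  <<s bit_cylinders >> [set bits : 'I_n -> nat -> bool | bits v k].
Proof.
pose X := g_sigma_algebraType (bit_cylinders : set (set ('I_n -> nat -> bool))).
(* There are finitely many tables of the first [k + 1] bits of all nodes. The values of [ext f]
   beyond [k] are arbitrary, since a cylinder of length [k + 1] ignores them. *)
pose ext (f : {ffun 'I_n * 'I_k.+1 -> bool}) (x : 'I_n) (i : nat) := f (x, inord i).
rewrite (_ : [set bits | _] = \bigcup_(f in [set f | ext f v k]) bit_cylinder k.+1 (ext f)).
  apply: (@fin_bigcup_measurable _ X) => [|f _]; first exact: finite_finset.
  by apply: sub_sigma_algebra; right; exists k.+1, (ext f).
apply/seteqP; split => [y yk|y [f /= fk] yf]; last by rewrite /= yf.
exists [ffun p : 'I_n * 'I_k.+1 => y p.1 p.2] => /= [|x i ik]; rewrite /ext ffunE /= inordK//.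
Qed.

Lemma measurable_bits_cylinders C : measurable_bits C -> <<s bit_cylinders >> C.
Proof.
apply: smallest_sub; first exact: smallest_sigma_algebra.
by move=> _ [v [k ->]]; exact: bit_in_cylinders.
Qed.

Lemma measurable_bit_cylinder K a : measurable_bits (bit_cylinder K a).
Proof.
pose X := g_sigma_algebraType
  [set C | exists v k, C = [set bits : 'I_n -> nat -> bool | bits v k]].
suff: measurable (bit_cylinder K a : set X) by [].
rewrite (_ : bit_cylinder K a =
  \bigcap_(p in [set: 'I_n * 'I_K]) [set bits | bits p.1 p.2 = a p.1 p.2]); last first.
  apply/seteqP; split => [y ya [v k] _|y ya v k kK] /=; first exact: ya.
  exact: (ya (v, Ordinal kK)).
apply: fin_bigcap_measurable => [|[v k] _ /=]; first exact: finite_finset.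
have mv : measurable ([set bits | bits v k] : set X).
  by apply: sub_sigma_algebra; exists v, k.
case: (a v k) => //.
have -> : (fun bits : X => bits v k = false) = ~` [set bits | bits v k]; last exact: measurableC.
by apply/seteqP; split => y /=; [move=> ->|move/negP/negbTE].
Qed.

(** Pi-lambda argument: the hypotheses prescribe the same values on cylinders, and the events on
    which both laws agree form a Dynkin system. *)
Lemma label_bits_law_unique L b L' b' s C :
  uniform_labelling_and_bits P L b -> uniform_labelling_and_bits P L' b' ->
  measurable_bits C ->
  P [set w | L w = s /\ C (b w)] = P [set w | L' w = s /\ C (b' w)].
Proof.
move=> ub ub' mC.
(* Cylinders of length 0 do not constrain the bits. *)
have lawT : P [set w | L w = s] = P [set w | L' w = s].
  have [_ _ /(_ s 0%N (fun _ _ => true))] := ub.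
  have [_ _ /(_ s 0%N (fun _ _ => true)) <-] := ub'.
  rewrite (_ : [set w | _ /\ _] = [set w | L w = s]); last by apply/seteqP; split => w //= [].
  by rewrite (_ : [set w | _ /\ _] = [set w | L' w = s])//; apply/seteqP; split => w //= [].
pose same : set (set ('I_n -> nat -> bool)) := [set D | measurable_bits D /\
  P [set w | L w = s /\ D (b w)] = P [set w | L' w = s /\ D (b' w)]].
suff : <<d bit_cylinders >> `<=` same.
  rewrite setI_closed_g_dynkin_g_sigma_algebra; last exact: setI_closed_bit_cylinders.
  by move=> /(_ C (measurable_bits_cylinders mC))[].
apply: smallest_sub; last first.
  move=> _ [->|[K [a ->]]]; split.
  - exact: sigma_algebra0.
  - rewrite (_ : [set w | _] = set0); last by apply/seteqP; split => w [].
    by rewrite (_ : [set w | _] = set0)//; apply/seteqP; split => w [].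
  - exact: measurable_bit_cylinder.
  - by have [_ _ ->] := ub; have [_ _ ->] := ub'.
split.
- split; first by have := @measurable_bit_cylinder 0 (fun _ _ => true);
    rewrite (_ : bit_cylinder _ _ = setT)//; apply/seteqP; split.
  rewrite (_ : [set w | _ /\ _] = [set w | L w = s]); last by apply/seteqP; split => w //= [].
  by rewrite (_ : [set w | _ /\ _] = [set w | L' w = s])//; apply/seteqP; split => w //= [].
- move=> D [mD PD]; split.
    by have [_ /(_ D mD) + _] := smallest_sigma_algebra setT
      [set C | exists v k, C = [set bits : 'I_n -> nat -> bool | bits v k]]; rewrite setTD.
  have splitC M c : uniform_labelling_and_bits P M c ->
      P [set w | M w = s /\ (~` D) (c w)] =
      (P [set w | M w = s] - P [set w | M w = s /\ D (c w)])%E.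
    move=> uM; rewrite -[X in (_ - P X)%E]/([set w | M w = s] `&` [set w | D (c w)]).
    rewrite -measureD ?setDE//; first by case: uM.
    + exact: measurable_bits_preimage uM mD.
    + by rewrite ltey_eq fin_num_measure//; case: uM.
  by rewrite (splitC _ _ ub) (splitC _ _ ub') PD lawT.
- move=> F tF sF; split; first by apply: sigma_algebra_bigcup => i; case: (sF i).
  have splitU M c : uniform_labelling_and_bits P M c ->
      P [set w | M w = s /\ (\bigcup_k F k) (c w)] =
      (\sum_(0 <= k <oo) P [set w | M w = s /\ F k (c w)])%E.
    move=> uM; rewrite -measure_semi_bigcup.
    + congr (P _); apply/seteqP; split => [w [Mw [k _ Fk]]|w [k _ [Mw Fk]]]; first by exists k.
      by split => //; exists k.
    + by move=> k; apply: measurable_label_bits uM _; case: (sF k).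
    + apply/trivIsetP => i j _ _ ij; apply/seteqP; split => // w [[_ Fi] [_ Fj]].
      by have /trivIsetP/(_ i j I I ij) := tF; rewrite -subset0 => /(_ (c w)); apply.
    + by apply: bigcup_measurable => k _; apply: measurable_label_bits uM _; case: (sF k).
  rewrite (splitU _ _ ub) (splitU _ _ ub'); apply: eq_eseriesr => k _.
  by case: (sF k).
Qed.

Lemma label_event_law_unique L b L' b' (E : {perm 'I_n} -> set ('I_n -> nat -> bool)) :
  uniform_labelling_and_bits P L b -> uniform_labelling_and_bits P L' b' ->
  (forall s, measurable_bits (E s)) ->
  P [set w | E (L w) (b w)] = P [set w | E (L' w) (b' w)].
Proof.
move=> ub ub' mE.
have splitE M c : uniform_labelling_and_bits P M c ->
    P [set w | E (M w) (c w)] = \sum_(s \in setT) P [set w | M w = s /\ E s (c w)].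
  move=> uM; rewrite -measure_fin_bigcup.
  - congr (P _); apply/seteqP; split => [w Ew|w [s _ [<- //]]]; first by exists (M w).
  - exact: finite_finset.
  - apply/trivIsetP => i j _ _ ij; apply/seteqP; split => // w [[Mi _] [Mj _]].
    by move: ij; rewrite -Mi -Mj eqxx.
  - by move=> s _; exact: measurable_label_bits uM _.
rewrite (splitE _ _ ub) (splitE _ _ ub').
by apply: eq_fsbigr => s _; exact: label_bits_law_unique.
Qed.

(** Exchangeability: the prescribed probability depends on neither [s] nor [a]. The left factor of a
    product acts first, so node [f v] receives the label and the bits of [v]. *)
Lemma uniform_labelling_and_bits_perm L b (f : {perm 'I_n}) :
  uniform_labelling_and_bits P L b ->
  uniform_labelling_and_bits P (fun w => (f^-1 * L w)%g) (fun w v => b w (f^-1%g v)).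
Proof.
move=> [mL mb law]; split => [s|v k|s K a].
- rewrite (_ : [set w | _] = [set w | L w = (f * s)%g]); first exact: mL.
  by apply/seteqP; split => w /=; [move=> <-; rewrite mulKVg|move=> ->; rewrite mulKg].
- exact: mb.
- rewrite -(law (f * s)%g K (fun v => a (f v))); congr (P _).
  apply/seteqP; split => w /= [Lw bw]; split.
  + by rewrite -Lw mulKVg.
  + by move=> v k kK; rewrite -bw// permK.
  + by rewrite Lw mulKg.
  + by move=> v k kK; rewrite bw// permKV.
Qed.

End RandomBits.

(** * Expectations of finitely valued random variables *)

Section FiniteValued.
Context (R : realType) (d : measure_display) (W : measurableType d)
  (P : probability W R) (F : finType) (X : W -> F).
Hypothesis mX : forall x, measurable [set w | X w = x].

Lemma expectation_finite (h : F -> R) : (forall x, 0 <= h x) ->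
  ('E_P[fun w => h (X w)])%E = (\sum_x h x * fine (P [set w | X w = x]))%:E.
Proof.
move=> h0; rewrite expectation.unlock.
transitivity (\int[P]_w \sum_x ((h x)%:E * (\1_[set w | X w = x] w)%:E))%E.
  apply: eq_integral => w _; rewrite (bigD1 (X w))//= big1 ?adde0.
    by rewrite indicE mem_set// mule1.
  by move=> x xw; rewrite indicE memNset ?mule0//= => wx; rewrite wx eqxx in xw.
rewrite ge0_integral_sum//; last 2 first.
- move=> x; apply: measurable_funeM; apply/measurable_EFinP.
  exact: measurable_indic.
- by move=> x w _; rewrite mule_ge0 ?lee_fin.
rewrite -sumEFin; apply: eq_bigr => x _.
rewrite ge0_integralZl//; last 2 first.
- by apply/measurable_EFinP; exact: measurable_indic.
- by rewrite lee_fin.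
by rewrite integral_indic// setIT EFinM fineK// fin_num_measure.
Qed.

Lemma probability_finite (Q : pred F) :
  P [set w | Q (X w)] = (\sum_x (Q x)%:R * fine (P [set w | X w = x]))%:E.
Proof.
rewrite -expectation_finite// expectation.unlock.
have mQ : measurable [set w | Q (X w)].
  rewrite (_ : [set w | _] = \bigcup_(x in [set x | Q x]) [set w | X w = x]).
    by apply: fin_bigcup_measurable => //; exact: finite_finset.
  by apply/seteqP; split => [w Qw|w [x Qx /= ->]//]; exists (X w).
rewrite -[X in P X]setIT -integral_indic//; apply: eq_integral => w _.
by rewrite indicE mem_setE.
Qed.

End FiniteValued.

(** * Expected loss per block *)

Lemma path_output_perm (n : nat) (A : local_algorithm) (T : nat) (f s : {perm 'I_n})
    (bits : 'I_n -> nat -> bool) (v : 'I_n) :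
  ball_iso (@path_edge n) f T v ->
  (f v \in path_output A T (f^-1 * s)%g (fun x => bits (f^-1%g x))) =
  (v \in path_output A T s bits).
Proof.
move=> iso; rewrite !inE; congr output; apply: run_perm iso => [x y|x|x].
- by move=> [] /val_inj/perm_inj.
- by rewrite /label_of permM permK.
- by rewrite permK.
Qed.

Lemma measurable_output_event (n : nat) (A : local_algorithm) (T : nat)
    (s : {perm 'I_n}) (Q : pred {set 'I_n}) :
  measurable_output n A T -> measurable_bits [set bits | Q (path_output A T s bits)].
Proof.
move=> mA; pose X := g_sigma_algebraType
  [set C | exists v k, C = [set bits : 'I_n -> nat -> bool | bits v k]].
rewrite (_ : [set bits | _] = \bigcup_(S in [set S | Q S]) \bigcap_(v in [set: 'I_n])
  [set bits : X | (v \in path_output A T s bits) = (v \in S)]); last first.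
  apply/seteqP; split => [y Qy|y [S QS yS]] /=.
    by exists (path_output A T s y).
  by rewrite (_ : path_output A T s y = S)//; apply/setP => v; exact: yS.
apply: (@fin_bigcup_measurable _ X) => [|S _]; first exact: finite_finset.
apply: fin_bigcap_measurable => [|v _]; first exact: finite_finset.
have mv : measurable ([set bits | v \in path_output A T s bits] : set X) by exact: mA.
case: (v \in S) => //.
have -> : [set bits : X | (v \in path_output A T s bits) = false] =
    ~` [set bits | v \in path_output A T s bits]; last exact: measurableC.
by apply/seteqP; split => y /=; [move=> ->|move/negP/negbTE].
Qed.

Section Blocks.
Context (R : realType) (d : measure_display) (W : measurableType d)
  (P : probability W R) (n : nat) (A : local_algorithm) (T : nat)
  (L : W -> {perm 'I_n.+1}) (b : W -> 'I_n.+1 -> nat -> bool).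
Hypotheses (mA : measurable_output n.+1 A T) (ub : uniform_labelling_and_bits P L b).

Let X w := path_output A T (L w) (b w).

(* The rotation of the positions from [u + T + 3] on fixes the view of the
   node at [u] and carries the view of the node at [u + 2T + 4] to that of its
   successor. *)
Lemma pair_law_shift (u : nat) : (u + 3 * T + 6 <= n)%N ->
  P [set w | (inord u \in X w) == (inord (u + 2 * T + 4) \in X w)] =
  P [set w | (inord u \in X w) == (inord (u + 2 * T + 4).+1 \in X w)].
Proof.
move=> un; have cn : (u + T + 3 <= n)%N by lia.
pose f := perm (rotate_tail_inj cn).
pose E (s : {perm 'I_n.+1}) := [set bits | (inord u \in path_output A T s bits) ==
                        (inord (u + 2 * T + 4).+1 \in path_output A T s bits)].
rewrite -[RHS]/(P [set w | E (L w) (b w)]).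
rewrite (label_event_law_unique ub (uniform_labelling_and_bits_perm f ub)); last first.
  by move=> s; exact: (measurable_output_event s
    (fun S : {set 'I_n.+1} => (inord u \in S) == (inord (u + 2 * T + 4).+1 \in S)) mA).
have fu : f (inord u) = inord u.
  by rewrite permE; apply: val_inj; rewrite /= rotate_tail_funE// inordK; [case: ifP|]; lia.
have fw : f (inord (u + 2 * T + 4)) = inord (u + 2 * T + 4).+1.
  rewrite permE; apply: val_inj.
  by rewrite /= rotate_tail_funE// !inordK; [case: ifP; [|case: ifP]| |]; lia.
congr (P _); apply: funext => w; rewrite /E /X /= -fw -{2}fu.
(* With [c = u + T + 3], the ball of [u] needs [u + T + 2 <= c]; that of [u + 2T + 4] needs
   [c + T < u + 2T + 4] and [u + 3T + 6 <= n]. *)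
by rewrite !path_output_perm//; apply: ball_iso_path; rewrite inordK; lia.
Qed.

(** This is [2E + J/2 <= n + 2], doubled. Room for [J + 1] blocks is asked so that the view at the
    right end of each of the [J] blocks used stays clear of the end of the path. *)
Lemma expected_size_block_bound (J : nat) :
  {ae P, forall w, independent (@path_edge n.+1) (X w)} ->
  (J.+1 * (2 * T + 5) <= n.+1)%N ->
  exists E : R, expected_size P X = E%:E /\ J%:R + 4 * E <= 2 * (n + 2)%:R.
Proof.
move=> indX JB.
have mX S : measurable [set w | X w = S].
  rewrite (_ : [set w | _] = [set w | [set bits | pred1 S (path_output A T (L w) bits)] (b w)]).
    apply: (measurable_label_event
      (E := fun s => [set bits | pred1 S (path_output A T s bits)]) ub) => s.
    exact: measurable_output_event.
  by apply/seteqP; split => w /= /eqP.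
pose p S := fine (P [set w | X w = S]).
have p0 S : 0 <= p S by exact: fine_ge0.
have p1 : \sum_S p S = 1.
  have := probability_finite P mX predT.
  rewrite (_ : [set w | _] = setT) ?probability_setT; last by apply/seteqP; split.
  by move=> -[->]; apply: eq_bigr => S _; rewrite mul1r.
have pind S : ~~ independent (@path_edge n.+1) S -> p S = 0.
  move=> nS; rewrite /p (_ : P _ = 0%E)//.
  apply: measure_negligible => //; apply: negligibleS indX => w /= ->.
  exact/negP.
exists (\sum_(S : {set 'I_n.+1}) #|S|%:R * p S); split; first exact: expectation_finite.
pose a u (S : {set 'I_n.+1}) : nat := (inord u \in S) == (inord (u + 2 * T + 4) \in S).
pose a' u (S : {set 'I_n.+1}) : nat := (inord u \in S) == (inord (u + 2 * T + 4).+1 \in S).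
pose B := (2 * T + 5)%N.
have lawE j : (j < J)%N -> \sum_S (a (j * B)%N S)%:R * p S = \sum_S (a' (j * B)%N S)%:R * p S.
  move=> jJ; have := @pair_law_shift (j * B)%N ltac:(rewrite /B; nia).
  rewrite (probability_finite P mX (fun S => (inord (j * B) \in S) == (inord (j * B + 2 * T + 4) \in S))).
  rewrite (probability_finite P mX (fun S => (inord (j * B) \in S) == (inord (j * B + 2 * T + 4).+1 \in S))).
  by case.
(* Disagreement is [1 - a]; moving [a] to the right avoids subtraction in [nat]. In expectation the
   sums of [a] and [a'] cancel by [lawE]. *)
have pointwise S : independent (@path_edge n.+1) S ->
    (\sum_(0 <= j < J) (1 + a' (j * B) S) + 4 * #|S| <=
     2 * (n + 2) + \sum_(0 <= j < J) a (j * B) S)%N.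
  move=> indS; have := card_zero_edges indS.
  have : (\sum_(0 <= j < J) (1 + a' (j * B) S) <= \sum_(0 <= j < J)
      (a (j * B) S + 2 * \sum_(j * B <= i < j * B + B) zero_edge S i))%N.
    rewrite big_nat [X in (_ <= X)%N]big_nat; apply: leq_sum => j /andP[_ jJ].
    have := @block_zero_edges n S (j * B) (2 * T + 4) indS ltac:(lia) ltac:(rewrite /B; nia).
    have -> : (2 * T + 4).+1 = B by rewrite /B; lia.
    rewrite [(j * B + (2 * T + 4))%N]addnA /a /a'.
    by case: (_ == (inord (j * B + 2 * T + 4) \in S)); rewrite ?add0n ?leq_add2l.
  rewrite [X in (_ <= X)%N]big_split /= -big_distrr /=.
  have := @blocks_zero_edges n B J S ltac:(rewrite /B; nia).
  have combine (x y q r k m : nat) : (x <= y -> q <= r + 2 * x -> 2 * k + y <= m ->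
    q + 4 * k <= 2 * m + r)%N by lia.
  exact: combine.
have expected : \sum_S (\sum_(0 <= j < J) (1 + a' (j * B)%N S) + 4 * #|S|)%:R * p S <=
    \sum_S (2 * (n + 2) + \sum_(0 <= j < J) a (j * B)%N S)%:R * p S.
  apply: ler_sum => S _; have [indS|nS] := boolP (independent (@path_edge n.+1) S).
    by rewrite ler_wpM2r// ler_nat; exact: pointwise.
  by rewrite (pind _ nS) !mulr0.
have meanE (x : R) : x = \sum_S x * p S by rewrite -mulr_sumr p1 mulr1.
move: expected.
have -> : \sum_S (\sum_(0 <= j < J) (1 + a' (j * B)%N S) + 4 * #|S|)%:R * p S =
    J%:R + \sum_(0 <= j < J) \sum_S (a' (j * B)%N S)%:R * p S + 4 * \sum_(S : {set 'I_n.+1}) #|S|%:R * p S.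
  rewrite exchange_big mulr_sumr [J%:R]meanE -!big_split /=.
  apply: eq_bigr => S _; rewrite big_split /= sum_nat_const_nat subn0 muln1.
  by rewrite natrD natrM natrD natr_sum -mulr_suml !mulrDl mulrA.
have -> : \sum_S (2 * (n + 2) + \sum_(0 <= j < J) a (j * B)%N S)%:R * p S =
    2 * (n + 2)%:R + \sum_(0 <= j < J) \sum_S (a (j * B)%N S)%:R * p S.
  rewrite exchange_big [2 * _]meanE -!big_split /=.
  apply: eq_bigr => S _.
  by rewrite natrD natrM natr_sum -mulr_suml mulrDl.
rewrite (eq_big_nat _ _ (F1 := fun j => \sum_S (a (j * B)%N S)%:R * p S)
  (F2 := fun j => \sum_S (a' (j * B)%N S)%:R * p S)); last first.
  by move=> j /andP[_ jJ]; exact: lawE.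
lra.
Qed.

End Blocks.

(** * Choice of constants and conclusion *)

Unset Implicit Arguments.

Theorem theorem26 (R : realType) :
  exists c : R, 0 < c /\ exists eps0 : R, 0 < eps0 /\
  forall eps : R, 0 < eps -> eps <= eps0 ->
  exists N : nat, forall n : nat, (N <= n)%N ->
  forall (A : local_algorithm) (T : nat), measurable_output n A T ->
  forall (d : measure_display) (W : measurableType d) (P : probability W R)
         (L : W -> {perm 'I_n}) (b : W -> 'I_n -> nat -> bool),
    uniform_labelling_and_bits P L b ->
    {ae P, forall w, independent (@path_edge n) (path_output A T (L w) (b w))} ->
    expected_approx_factor_le P (fun w => path_output A T (L w) (b w)) (1 + eps) ->
    c / eps <= T%:R.
Proof.
(* If [T * eps < 1/20] and [eps <= 1/50], then [(2T + 5) * eps < 1/10 + 1/10 = 1/5]. *)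
exists (1 / 20); split; first by lra.
exists (1 / 50); split => [|eps eps_gt0 eps_le]; first by lra.
exists (Num.truncn (2 / eps)).+1 => -[|n]; first by rewrite ltn0.
move=> nN A T mA d W P L b ub indX apx.
rewrite leNgt; apply/negP => T_lt.
have n_gt : 2 < n.+1%:R * eps.
  rewrite -ltr_pdivrMr//; apply: lt_le_trans (truncnS_gt _) _.
  by rewrite ler_nat.
have {}T_lt : T%:R * eps < 1 / 20 by rewrite -ltr_pdivlMr.
pose B := (2 * T + 5)%N; pose J := (n.+1 %/ B).-1.
have BE : B%:R = 2 * T%:R + 5 :> R by rewrite natrD natrM.
have B_lt : B%:R * eps < 1 / 5 by rewrite BE; nra.
have nB : (B <= n.+1)%N.
  rewrite -(ler_nat R) -(ler_pM2r eps_gt0); lra.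
have B_gt0 : (0 < B)%N by rewrite addn_gt0 orbT.
have JS : J.+1 = (n.+1 %/ B)%N by rewrite prednK// divn_gt0.
have JB : (J.+1 * B <= n.+1)%N by rewrite JS leq_trunc_div.
have JB' : (n.+1 < J.+2 * B)%N by rewrite JS ltn_ceil.
have [E [EX JE]] := expected_size_block_bound mA ub indX JB.
move: apx; rewrite /expected_approx_factor_le EX -EFinM lee_fin => apx.
have alphaE : n.+1%:R <= 2 * (alpha (@path_edge n.+1))%:R :> R.
  by rewrite -natrM ler_nat alpha_path_ge.
have J_ge : n.+1%:R < (J%:R + 2) * B%:R :> R.
  by rewrite -natrD -natrM ltr_nat addn2.
have nE : (n + 2)%:R = n.+1%:R + 1 :> R by rewrite natr1 addn2.
have J0 : 0 <= J%:R :> R by [].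
have epsJ : 5 * (n.+1%:R * eps) < J%:R + 2.
  have : n.+1%:R * eps < (J%:R + 2) * (B%:R * eps) by rewrite mulrA ltr_pM2r.
  have : (J%:R + 2) * (B%:R * eps) <= (J%:R + 2) * (1 / 5) by rewrite ler_pM2l; lra.
  lra.
rewrite nE in JE; set N := n.+1%:R in n_gt alphaE JE epsJ *.
(* As [2N <= 4(1 + eps)E], this yields [J <= 2 + 2 N eps + 2 eps]. With [5 N eps < J + 2] it follows
   that [3 N eps < 4 + 2 eps], which contradicts [N eps > 2]. *)
have : (1 + eps) * (4 * E) <= (1 + eps) * (2 * (N + 1) - J%:R) by rewrite ler_pM2l; lra.
have : 0 <= eps * J%:R by rewrite mulr_ge0// ltW.
nra.
Qed.
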